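(* Let $\mathcal{H}$ be a hereditarily closed family of finite bipartite graphs of the form $H=(E;X,Y)$ with $E\subseteq X\times Y$. The following are equivalent: (1) for any ultraproduct $\widetilde H=(\widetilde E;\widetilde X,\widetilde Y)$ of the graphs from $\mathcal{H}$, there exists a partition of $\widetilde X$ into countably many perfect sets (for $\widetilde E$) from $\mathcal{B}_{\widetilde X}$; (2) for every $\varepsilon\in\mathbb{R}_{>0}$ and every function $f:\mathbb{N}\to(0,1]$ there exists some $N=N(f,\varepsilon)$ so that: for any $H=(E;X,Y)\in\mathcal{H}$ there exist $N'\le N$ and a partition $X=\bigsqcup_{0\le t<N'}A_t$ so that: (a) $|A_0|\le\varepsilon|X|$; (b) for any $1\le t<N'$, the set $A_t$ is $f(N')$-decent for $E$.
   Context: A finite bipartite graph is $H=(E;X,Y)$ with $X,Y$ finite nonempty sets, $E\subseteq X\times Y$; finite sets carry the uniform probability measures. A family $\mathcal{H}$ is hereditarily closed if whenever $(E;X,Y)\in\mathcal{H}$ and $X'\subseteq X$, $Y'\subseteq Y$ are nonempty, also $(E\cap(X'\times Y');X',Y')\in\mathcal{H}$. Let $E\subseteq X\times Y$ be measurable, and $E_b=\{a\in X:(a,b)\in E\}$ for $b\in Y$. A measurable set $A\subseteq X$ is $\varepsilon$-decent for $E$ if $\mu\left(\{b\in Y:\mu(A\cap E_b)>\varepsilon\mu(A)\text{ and }\mu(A\setminus E_b)>\varepsilon\mu(A)\}\right)\le\varepsilon$. It is perfect for $E$ if it is $0$-decent, i.e. for almost every $b\in Y$, $\mu(A\cap E_b)=0$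 or $\mu(A\setminus E_b)=0$. Ultraproducts: given $H_n=(E_n;X_n,Y_n)\in\mathcal{H}$, $n\in\mathbb{N}$, and an ultrafilter $\mathcal{U}$ on $\mathbb{N}$, let $\widetilde X=\prod_nX_n/\mathcal{U}$, $\widetilde Y=\prod_nY_n/\mathcal{U}$, $\widetilde E=\prod_nE_n/\mathcal{U}$. For $S$ any finite product of the vertex sorts, internal subsets of $\widetilde S$ are those of the form $\prod_nA_n/\mathcal{U}$ with $A_n\subseteq S_n$; $\mathcal{B}_{\widetilde S}$ is the $\sigma$-algebra they generate and $\mu_{\widetilde S}$ the unique countably additive probability measure on it with $\mu_{\widetilde S}(\prod_nA_n/\mathcal{U})=\lim_{n\to\mathcal{U}}|A_n|/|S_n|$. Parts of partitions may be empty. *)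

(* Defs.v *)
From HB Require Import structures.
From mathcomp Require Import all_boot all_order all_algebra generic_quotient.
From mathcomp Require Import all_classical all_reals all_analysis.

Set Implicit Arguments.
Unset Strict Implicit.
Unset Printing Implicit Defensive.

Import Order.TTheory GRing.Theory Num.Theory.
Import numFieldTopology.Exports numFieldNormedType.Exports.

Local Open Scope classical_set_scope.
Local Open Scope ring_scope.

Record neFinType := NeFinType {
  neFin_sort :> finType;
  neFin_gt0 : (0 < #|neFin_sort|)%N }.

Record bigraph := Bigraph {
  vX : neFinType;
  vY : neFinType;
  edges : {set vX * vY} }.

Lemma card_sub_gt0 (T : finType) (A : {set T}) :
  (0 < #|A|)%N -> (0 < #|{: {x : T | x \in A}}|)%N.
Proof. by rewrite card_sig. Qed.

Definition subNeFin (T : neFinType) (A : {set T}) (A0 : (0 < #|A|)%N) :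
  neFinType := NeFinType (card_sub_gt0 A0).

Definition induced (H : bigraph) (X' : {set vX H}) (Y' : {set vY H})
    (X'0 : (0 < #|X'|)%N) (Y'0 : (0 < #|Y'|)%N) : bigraph :=
  @Bigraph (subNeFin X'0) (subNeFin Y'0)
    [set e : {x : vX H | x \in X'} * {y : vY H | y \in Y'}
      | (val e.1, val e.2) \in edges H]%SET.

(** As graphs live on types, the subgraph induced on [X'] and [Y'] lives on
    the corresponding subtypes.  Invariance under isomorphism is not assumed. *)
Definition hereditarily_closed (F : bigraph -> Prop) : Prop :=
  forall H, F H ->
  forall (X' : {set vX H}) (Y' : {set vY H})
    (X'0 : (0 < #|X'|)%N) (Y'0 : (0 < #|Y'|)%N), F (induced X'0 Y'0).

Section decent.
Context {R : realType} {X Y : Type}.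
Variables (mu : set X -> \bar R) (nu : set Y -> \bar R).

Definition fiber (E : set (X * Y)) (b : Y) : set X := [set a | E (a, b)].

Definition decent (eps : R) (E : set (X * Y)) (A : set X) : Prop :=
  (nu [set b | (eps%:E * mu A < mu (A `&` fiber E b))%E /\
               (eps%:E * mu A < mu (A `\` fiber E b))%E] <= eps%:E)%E.

Definition perfect (E : set (X * Y)) (A : set X) : Prop := decent 0 E A.

End decent.

Definition uniform_measure (R : realType) (T : finType) (A : set T) : \bar R :=
  (#|[pred x : T | x \in A]|%:R / #|T|%:R)%:E.

Section ultraproduct.
Context (U : set_system nat) {UU : UltraFilter U} (S : nat -> neFinType).

Definition ueq : rel (forall n, S n) :=
  fun x y => `[< \forall n \near U, x n = y n >].

Lemma ueq_refl : reflexive ueq.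
Proof. by move=> x; apply/asboolP; exact: filterE. Qed.

Lemma ueq_sym : symmetric ueq.
Proof.
by move=> x y; apply/asboolP/asboolP; apply: filterS => n ->.
Qed.

Lemma ueq_trans : transitive ueq.
Proof.
move=> y x z /asboolP xy /asboolP yz; apply/asboolP.
by apply: filterS2 xy yz => n -> ->.
Qed.

Canonical ueq_equiv := EquivRel ueq ueq_refl ueq_sym ueq_trans.

Definition uprod : Type := {eq_quot ueq}%qT.

HB.instance Definition _ := Choice.on uprod.
HB.instance Definition _ := Quotient.on uprod.
HB.instance Definition _ := isPointed.Build uprod
  (\pi_uprod%qT (fun n => enum_val (Ordinal (neFin_gt0 (S n))))).

Lemma repr_piE (x : forall n, S n) :
  \forall n \near U, repr (\pi_uprod%qT x) n = x n.
Proof.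
suff : ueq (repr (\pi_uprod%qT x)) x by move/asboolP.
have := @eqmodP _ ueq_equiv (repr (\pi_uprod%qT x)) x.
by move=> P; apply/P; exact: reprK.
Qed.

(** The internal set prod_n A_n / U: the classes of the sequences that lie in
    [A n] for [U]-almost all [n], which handles sequences in which some [A n]
    are empty. *)
Definition iset (A : forall n, {set S n}) : set uprod :=
  [set q | \forall n \near U, repr q n \in A n].

Definition internal : set (set uprod) := range iset.

Lemma iset_pi (A : forall n, {set S n}) (x : forall n, S n) :
  iset A (\pi_uprod%qT x) <-> \forall n \near U, x n \in A n.
Proof. by split; apply: filterS2 (repr_piE x) => n ->. Qed.

Lemma iset0 : iset (fun=> finset.set0) = set0.
Proof.
apply/seteqP; split=> // q /filter_ex[n] /=; by rewrite finset.in_set0.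
Qed.

Lemma isetT : iset (fun=> finset.setT) = setT.
Proof.
by apply/seteqP; split=> // q _; apply: filterE => n; rewrite finset.in_setT.
Qed.

Lemma isetC A : ~` iset A = iset (fun n => ~: A n)%SET.
Proof.
apply/seteqP; split=> q /=.
  move=> nA; have [//|] := in_ultra_setVsetC [set n | repr q n \in A n] UU.
  by apply: filterS => n /= /negP; rewrite finset.in_setC.
move=> cA AA; have [n] := filter_ex (filterI cA AA).
by case=> /=; rewrite finset.in_setC => /negP.
Qed.

Lemma isetI A B : iset A `&` iset B = iset (fun n => A n :&: B n)%SET.
Proof.
apply/seteqP; split=> q /=.
  by case; apply: filterS2 => n; rewrite finset.in_setI => -> ->.
by move=> AB; split; apply: filterS AB => n; rewrite finset.in_setI => /andP[].
Qed.

Lemma isetU A B : iset A `|` iset B = iset (fun n => A n :|: B n)%SET.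
Proof.
rewrite -[LHS]setCK setCU !isetC isetI isetC; congr iset.
by apply: functional_extensionality_dep => n; rewrite finset.setCI !finset.setCK.
Qed.

Lemma iset_sub A B :
  iset A `<=` iset B -> \forall n \near U, (A n \subset B n)%SET.
Proof.
move=> AB.
pose x n : S n := odflt (enum_val (Ordinal (neFin_gt0 (S n))))
  [pick a in (A n :\: B n)%SET].
have [//|nAB] := in_ultra_setVsetC [set n | A n \subset B n] UU.
have xAB : \forall n \near U, x n \in (A n :\: B n)%SET.
  apply: filterS nAB => n /= /negP; rewrite -finset.setD_eq0 => /finset.set0Pn[a aAB].
  by rewrite /x; case: pickP => [//|/(_ a)]; rewrite aAB.
have xA : iset A (\pi_uprod%qT x).
  by apply/iset_pi; apply: filterS xAB => n; rewrite inE => /andP[].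
have /iset_pi xB := AB _ xA.
have [n] := filter_ex (filterI xAB xB).
by rewrite /= inE => -[/andP[/negP]].
Qed.

Lemma iset_eq A B : iset A = iset B -> \forall n \near U, A n = B n.
Proof.
move=> AB; have sAB : iset A `<=` iset B by rewrite AB.
have sBA : iset B `<=` iset A by rewrite AB.
apply: filterS2 (iset_sub sAB) (iset_sub sBA) => n ab ba.
by apply/eqP; rewrite finset.eqEsubset ab.
Qed.

Fact internal_display : measure_display. Proof. exact. Qed.

Lemma internal0 : internal set0.
Proof. by exists (fun=> finset.set0); rewrite ?iset0. Qed.

Lemma internalU : setU_closed internal.
Proof.
move=> _ _ [A _ <-] [B _ <-]; rewrite isetU.
by exists (fun n => A n :|: B n)%SET.
Qed.

Lemma internalC : setC_closed internal.
Proof.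
by move=> _ [A _ <-]; rewrite isetC; exists (fun n => ~: A n)%SET.
Qed.

HB.instance Definition _ := @isAlgebraOfSets.Build internal_display uprod
  internal internal0 internalU internalC.

Lemma internal_saturation (A : set uprod) (F : nat -> set uprod) :
  internal A -> (forall k, internal (F k)) -> A `<=` \bigcup_k F k ->
  exists K, A `<=` \big[setU/set0]_(k < K) F k.
Proof.
move=> [a _ <-] /= iF AF.
have /choice[f fF] : forall k, exists f, iset f = F k.
  by move=> k; have [f _] := iF k; exists f.
apply: contrapT => /forallNP nAF.
pose B n k := (a n :\: \bigcup_(j < k) f j n)%SET.
have B_decr n k l : (k <= l)%N -> (B n l \subset B n k)%SET.
  move=> kl; apply: finset.setDS; apply/finset.bigcupsP => j _.
  exact: (finset.bigcup_sup (widen_ord kl j)).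
have /(_ _)/cid-/all_sig[x xB] : forall n, exists x : S n,
    forall k, B n k != finset.set0 -> x \in B n k.
  move=> n; apply: contrapT => /forallNP nx.
  have /choice[k kP] : forall x : S n, exists k,
      B n k != finset.set0 /\ x \notin B n k.
    move=> x; have /existsNP[k /not_implyP[? /negP ?]] := nx x.
    by exists k.
  pose x0 : S n := enum_val (Ordinal (neFin_gt0 (S n))).
  have [m _ km] := @arg_maxnP (S n) x0 predT k isT.
  have [/finset.set0Pn[y yB] _] := kP m.
  have [_ /negP] := kP y; apply.
  exact: (fintype.subsetP (B_decr n _ _ (km y isT))).
have BU k : \forall n \near U, B n k != finset.set0.
  have /existsNP[q /not_implyP[aq nFq]] := nAF k.
  have nf : \forall n \near U, forall j : 'I_k, repr q n \notin f j n.
    apply: (@filter_forall _ 'I_k (fun j n => repr q n \notin f j n)) => j.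
    have [fjq|//] := in_ultra_setVsetC [set n | repr q n \in f j n] UU.
      exfalso; apply: nFq; rewrite -bigcup_mkord; exists j => //=.
      by rewrite -fF.
    by apply: filterS => n /= /negP.
  apply: filterS2 aq nf => n aqn nfn; apply/finset.set0Pn; exists (repr q n).
  rewrite inE aqn andbT; apply/negP => /finset.bigcupP[j _ qf].
  by have := nfn j; rewrite qf.
have xA : iset a (\pi_uprod%qT x).
  apply/iset_pi; apply: filterS (BU 0) => n /xB.
  by rewrite inE => /andP[].
have [k _] := AF _ xA; rewrite -fF => /iset_pi xf.
have [n [/= xfn /xB]] := filter_ex (filterI xf (BU k.+1)).
rewrite inE => /andP[/negP + _]; apply.
by apply/finset.bigcupP; exists ord_max.
Qed.

End ultraproduct.

Arguments uprod U {UU} S.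
Arguments iset U {UU} S A.
Arguments internal U {UU} S.

Section loeb.
Context (R : realType) (U : set_system nat) {UU : UltraFilter U}
  (S : nat -> neFinType).

Definition density (A : forall n, {set S n}) (n : nat) : R :=
  #|A n|%:R / #|S n|%:R.

Definition ulim (u : nat -> R) : R := lim (u @ U).

Lemma ulim_cvg (u : nat -> R) : (forall n, 0 <= u n <= 1) -> u @ U --> ulim u.
Proof.
move=> u01.
have cu : cvg (u @ U); last exact: cu.
have uI : \forall n \near U, `[0%R, 1%R]%classic (u n).
  by apply: filterE => n; rewrite /= in_itv; exact: u01.
have [p [_ pu]] := @segment_compact R 0 1 (u @ U) _ uI.
apply/cvg_ex; exists p => V pV.
have [//|nV] := in_ultra_setVsetC (u @^-1` V) UU.
have [x [/= ]] := pu (~` V) V nV pV.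
by [].
Qed.

Lemma density01 A n : 0 <= density A n <= 1.
Proof.
have S0 : 0 < #|S n|%:R :> R by rewrite ltr0n neFin_gt0.
by rewrite divr_ge0//= ler_pdivrMr// mul1r ler_nat max_card.
Qed.

Lemma density_cvg A : density A @ U --> ulim (density A).
Proof. by apply: ulim_cvg => n; exact: density01. Qed.

(** Only meaningful when [Q] is internal; by [icontentE] the value does not
    depend on the sequence representing [Q]. *)
Definition icontent (Q : set (uprod U S)) : \bar R :=
  (ulim (density (xget (fun=> finset.set0) [set A | iset U S A = Q])))%:E.

Lemma icontentE A : icontent (iset U S A) = (ulim (density A))%:E.
Proof.
rewrite /icontent; set B := xget _ _.
have /iset_eq BA : iset U S B = iset U S A.
  by apply: (@xgetPex _ (fun=> finset.set0) [set B | iset U S B = iset U S A]);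
    exists A.
congr _%:E; apply/cvg_lim => //; apply: cvg_trans (@density_cvg A).
by apply: near_eq_cvg; apply: filterS BA => n; rewrite /density => ->.
Qed.

Let icontent_ge0 Q : (0 <= icontent Q)%E.
Proof.
rewrite lee_fin; apply: limr_ge; first exact: density_cvg.
by apply: filterE => n; have /andP[] := density01
  (xget (fun=> finset.set0) [set A | iset U S A = Q]) n.
Qed.

Let icontent0 : icontent set0 = 0%E.
Proof.
rewrite -iset0 icontentE; congr _%:E.
rewrite (_ : density _ = cst 0); first exact: lim_cst.
by apply/funext => n; rewrite /density cards0 mul0r.
Qed.

Let icontent_additive2 : additive2 icontent.
Proof.
move=> _ _ [A _ <-] [B _ <-]; rewrite isetI -[X in _ = X -> _]iset0.
move=> /iset_eq AB0; rewrite isetU !icontentE -EFinD; congr _%:E.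
apply/cvg_lim => //.
apply: cvg_trans (cvgD (@density_cvg A) (@density_cvg B)).
apply: near_eq_cvg; apply: filterS AB0 => n AB0.
by rewrite /density cardsU AB0 cards0 subn0 natrD mulrDl.
Qed.

HB.instance Definition _ := isContent.Build _ (uprod U S) R icontent
  icontent_ge0 ((additive2P icontent0).2 icontent_additive2).

Let icontent_sigma_subadditive : measurable_subset_sigma_subadditive icontent.
Proof.
move=> A F mF mA AF.
have [K AK] := internal_saturation mA mF AF.
have := @content_subadditive _ _ _ icontent A F K (fun k _ => mF k) mA AK.
move=> /le_trans; apply.
rewrite -(big_mkord xpredT (fun k => icontent (F k))).
exact: nneseries_lim_ge.
Qed.

HB.instance Definition _ :=
  Content_SigmaSubAdditive_isMeasure.Build _ R (uprod U S) icontent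
    icontent_sigma_subadditive.

Definition loeb_space := g_sigma_algebraType (internal U S).

(** The extension is an outer measure on all sets; it is countably additive on
    the sigma-algebra of [loeb_space], where it is characterised by
    [loeb_measure_iset] and [loeb_measure_unique]. *)
Definition loeb_measure : set loeb_space -> \bar R :=
  measure_extension icontent.

HB.instance Definition _ := Measure.on loeb_measure.

Lemma loeb_measure_iset (A : forall n, {set S n}) :
  loeb_measure (iset U S A) = (ulim (density A))%:E.
Proof.
by rewrite -icontentE /loeb_measure /measure_extension measurable_mu_extE//;
  exists A.
Qed.

Let loeb_measure_setT : loeb_measure setT = 1%E.
Proof.
rewrite -isetT loeb_measure_iset; congr _%:E.
rewrite (_ : density _ = cst 1); first exact: lim_cst.
apply/funext => n; rewrite /density cardsT divff// pnatr_eq0 -lt0n.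
exact: neFin_gt0.
Qed.

HB.instance Definition _ :=
  Measure_isProbability.Build _ _ _ loeb_measure loeb_measure_setT.

Lemma loeb_measure_unique (P : probability loeb_space R) :
  (forall A, P (iset U S A) = (ulim (density A))%:E) ->
  forall Q : set loeb_space, measurable Q -> P Q = loeb_measure Q.
Proof.
move=> PE Q mQ; apply/esym; apply: measure_extension_unique => //.
- exists (fun=> setT); first by rewrite bigcup_const//; exists 0%N.
  by move=> _; split; [exact: measurableT|exact: ltry].
- move=> _ [A _ <-]; exact: (etrans (icontentE A) (esym (PE A))).
Qed.

End loeb.

Arguments loeb_space U {UU} S.
Arguments loeb_measure R U {UU} S.

(** The internal subset prod_n E_n / U of the product of the two sorts. *)
Definition uedges (U : set_system nat) {UU : UltraFilter U}
    (G : nat -> bigraph) :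
    set (uprod U (fun n => vX (G n)) * uprod U (fun n => vY (G n))) :=
  [set p | \forall n \near U, (repr p.1 n, repr p.2 n) \in edges (G n)].
Arguments uedges U {UU} G.

(* Main.v *)
Require Import Defs.
From mathcomp Require Import all_boot all_order all_algebra.
From mathcomp Require Import all_classical all_reals all_analysis.
From mathcomp Require Import ring lra.

Import Order.TTheory GRing.Theory Num.Theory.
Import numFieldNormedType.Exports.

Set Implicit Arguments.
Unset Strict Implicit.
Unset Printing Implicit Defensive.

Local Open Scope classical_set_scope.
Local Open Scope ring_scope.

(** (1) => (2): if no bound N exists for some eps and f, take an ultraproduct,
    along a nonprincipal ultrafilter, of graphs G_n refuting the bound n.
    Finitely many of the perfect sets, K say, carry measure > 1 - eps/2; replace
    each of them by an internal subset of almost the same measure.  An internal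
    perfect set of positive measure is c-decent in almost every G_n for every
    c > 0, in particular for c = f(K+1), so almost every G_n has a partition
    into K+1 sets after all.

    (2) => (1): every internal set Z of positive measure contains an internal
    perfect set of positive measure.  Otherwise, by saturation, for each a > 0
    there is k(a) such that, in almost every G_n, no subset of Z_n of density
    at least a is 1/(k(a)+1)-decent; applying (2) to the subgraphs induced on
    Z_n with f built from k gives a part contradicting this.  Perfect sets then
    exhaust the ultraproduct up to a null set, as the supremum of the measures
    of the internal sets covered by countably many of them must be 1. *)

(** * Saturation over finite sets *)

(** If each [x] failed some satisfiable level [k x], take the largest of these finitely many levels:
    a witness [y] of it would, by monotonicity, satisfy the lower level [k y] too. *)
Lemma finite_saturation (T : finType) (x0 : T) (P : nat -> T -> Prop) :
  (forall j k x, (j <= k)%N -> P k x -> P j x) ->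
  exists x, forall k, (exists y, P k y) -> P k x.
Proof.
move=> Pd; apply: contrapT => /forallNP nP.
have /choice[k kP] : forall x, exists k, (exists y, P k y) /\ ~ P k x.
  by move=> x; have /existsNP[k /not_implyP] := nP x; exists k.
have [m _ km] := @arg_maxnP T x0 predT k isT.
have [[y Py] _] := kP m.
by have [_] := kP y; apply; exact: Pd (km y isT) Py.
Qed.

Lemma near_contra (U : set_system nat) {UU : UltraFilter U} (P : nat -> Prop) :
  ~ (\forall n \near U, P n) -> \forall n \near U, ~ P n.
Proof. by move=> nP; have [] := in_ultra_setVsetC P UU. Qed.

(** * Limits of densities, and approximation of measurable sets by internal ones *)

Section ultraproduct.
Context {R : realType} {U : set_system nat} {UU : UltraFilter U}
  {S : nat -> neFinType}.
Implicit Types A B : forall n, {set S n}.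

(* As each [A n] is optimal for all [k] at once, [U] may be principal. *)
Lemma iset_saturation (P : nat -> forall n, {set S n} -> Prop) :
  (forall j k n C, (j <= k)%N -> P k n C -> P j n C) ->
  (forall k, \forall n \near U, exists C, P k n C) ->
  exists A : forall n, {set S n}, forall k, \forall n \near U, P k n (A n).
Proof.
move=> Pd exP.
have /(_ _)/cid-/all_sig[A AP] n : exists A : {set S n},
    forall k, (exists C, P k n C) -> P k n A.
  apply: (finite_saturation finset.set0 (P := fun k => P k n)) => j k A.
  exact: Pd.
by exists A => k; apply: filterS (exP k) => n /AP.
Qed.

Lemma iset_bigcup (F : nat -> forall n, {set S n}) k :
  iset U S (fun n => \bigcup_(j < k) F j n)%SET =
  \bigcup_(j < k) iset U S (F j).
Proof.
rewrite bigcup_mkord; elim: k => [|k IH].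
  rewrite big_ord0 -(@iset0 U _ S); congr (iset U S _).
  by apply: functional_extensionality_dep => n; rewrite big_ord0.
rewrite big_ord_recr/= -IH isetU; congr (iset U S _).
by apply: functional_extensionality_dep => n; rewrite big_ord_recr.
Qed.

Lemma ulim_density01 A : 0 <= ulim U (density R A) <= 1.
Proof.
have Ac := @density_cvg R U _ S A; apply/andP; split.
  apply: limr_ge; first exact: Ac.
  by apply: filterE => n; have /andP[] := density01 R A n.
apply: limr_le; first exact: Ac.
by apply: filterE => n; have /andP[] := density01 R A n.
Qed.

Lemma ulim_density_le A (r : R) :
  (\forall n \near U, density R A n <= r) -> ulim U (density R A) <= r.
Proof. by apply: limr_le; exact: density_cvg. Qed.

Lemma ulim_density_ge A (r : R) :
  (\forall n \near U, r <= density R A n) -> r <= ulim U (density R A).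
Proof. by apply: limr_ge; exact: density_cvg. Qed.

Lemma near_density_lt A (r : R) :
  ulim U (density R A) < r -> \forall n \near U, density R A n < r.
Proof. exact: (cvgr_lt _ (@density_cvg R U _ S A)). Qed.

Lemma near_density_gt A (r : R) :
  r < ulim U (density R A) -> \forall n \near U, r < density R A n.
Proof. exact: (cvgr_gt _ (@density_cvg R U _ S A)). Qed.

(** Monotonicity of an outer measure. It thus applies to the exceptional sets of vertices [b] in
    [decent], whose measurability is never established. *)
Lemma loeb_measure_mono (P Q : set (loeb_space U S)) :
  P `<=` Q -> (loeb_measure R U S P <= loeb_measure R U S Q)%E.
Proof. exact: (@le_mu_ext _ (uprod U S) R (@icontent R U _ S)). Qed.

Lemma loeb_measure0 : loeb_measure R U S set0 = 0%E.
Proof. exact: measure0. Qed.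

Lemma loeb_measure_bigcup0 (D : nat -> set (loeb_space U S)) :
  (forall k, loeb_measure R U S (D k) = 0%E) ->
  loeb_measure R U S (\bigcup_k D k) = 0%E.
Proof.
move=> D0; apply/eqP; rewrite eq_le measure_ge0 andbT.
have := @mu_ext_sigma_subadditive _ (uprod U S) R (@icontent R U _ S)
  (measure_ge0 _) D.
by move=> /le_trans; apply; rewrite eseries0// => k _ _; exact: D0.
Qed.

Lemma measurable_iset A : measurable (iset U S A : set (loeb_space U S)).
Proof. by apply: sub_sigma_algebra; exists A. Qed.

Lemma ulim_densityD A B :
  (\forall n \near U, A n :&: B n = finset.set0)%SET ->
  ulim U (density R (fun n => A n :|: B n)%SET) =
  ulim U (density R A) + ulim U (density R B).
Proof.
move=> AB0; apply/cvg_lim => //.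
apply: cvg_trans (cvgD (@density_cvg R U _ S A) (@density_cvg R U _ S B)).
apply: near_eq_cvg; apply: filterS AB0 => n AB0.
by rewrite /density cardsU AB0 cards0 subn0 natrD mulrDl.
Qed.

Lemma ulim_densityC A :
  ulim U (density R (fun n => ~: A n)%SET) = 1 - ulim U (density R A).
Proof.
apply/eqP; rewrite eq_sym subr_eq -ulim_densityD; last first.
  by apply: filterE => n; rewrite finset.setIC finset.setICr.
apply/eqP/esym/cvg_lim => //; apply: cvg_near_cst; apply: filterE => n.
rewrite /density finset.setUC finset.setUCr cardsT divff//.
by rewrite pnatr_eq0 -lt0n neFin_gt0.
Qed.

Lemma ulim_density_mono A B :
  iset U S A `<=` iset U S B -> ulim U (density R A) <= ulim U (density R B).
Proof.
by move=> AB; rewrite -lee_fin -!loeb_measure_iset; exact: loeb_measure_mono.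
Qed.

Lemma ulim_density0 : ulim U (density R (fun n => finset.set0 : {set S n})) = 0.
Proof.
by have := loeb_measure0; rewrite -(@iset0 U _ S) loeb_measure_iset => -[].
Qed.

Lemma ulim_densityU_le A B :
  ulim U (density R (fun n => A n :|: B n)%SET) <=
  ulim U (density R A) + ulim U (density R B).
Proof.
rewrite [X in density R X](_ : _ = fun n => A n :|: (B n :\: A n))%SET; last first.
  apply: functional_extensionality_dep => n; apply/setP => x; rewrite !inE.
  by case: (x \in A n).
rewrite ulim_densityD ?lerD2l; last first.
  by apply: filterE => n; apply/setP => x; rewrite !inE; case: (x \in A n).
apply: ulim_density_mono => q; apply: filterS => n.
by rewrite inE => /andP[].
Qed.

Lemma ulim_density_bigcup_le (F : nat -> forall n, {set S n}) k :
  ulim U (density R (fun n => \bigcup_(j < k) F j n)%SET) <=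
  \sum_(j < k) ulim U (density R (F j)).
Proof.
elim: k => [|k IH].
  rewrite big_ord0 -ulim_density0; apply: ulim_density_mono => q.
  by apply: filterS => n; rewrite big_ord0.
rewrite big_ord_recr/=; apply: le_trans (lerD IH (lexx _)).
apply: le_trans (ulim_densityU_le _ _); apply: ulim_density_mono => q.
by apply: filterS => n; rewrite big_ord_recr.
Qed.

Lemma ulim_density_bigcup (F : nat -> forall n, {set S n}) k :
  (forall i j, (i < j)%N ->
    \forall n \near U, F i n :&: F j n = finset.set0)%SET ->
  ulim U (density R (fun n => \bigcup_(j < k) F j n)%SET) =
  \sum_(j < k) ulim U (density R (F j)).
Proof.
move=> F0; elim: k => [|k IH].
  rewrite big_ord0 -ulim_density0; congr (ulim U (density R _)).
  by apply: functional_extensionality_dep => n; rewrite big_ord0.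
rewrite big_ord_recr/= -IH -ulim_densityD; last first.
  have : \forall n \near U, forall j : 'I_k, (F j n :&: F k n)%SET = finset.set0.
    by apply: filter_forall => j; exact: F0.
  apply: filterS => n F0n; apply/eqP; rewrite -finset.subset0.
  apply/fintype.subsetP => x; rewrite inE => /andP[/finset.bigcupP[j _ xj] xk].
  by rewrite -(F0n j) inE xj.
congr (ulim U (density R _)).
by apply: functional_extensionality_dep => n; rewrite big_ord_recr.
Qed.

(** By saturation: at level [k] the union of the first [k] sets is itself a witness, the slack [d]
    turning a bound on its limit density into one valid in almost every factor. A single internal
    set thus swallows a countable union. *)
Lemma internal_cover (F : nat -> forall n, {set S n}) (r d : R) : 0 < d ->
  (forall k, ulim U (density R (fun n => \bigcup_(j < k) F j n)%SET) <= r) ->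
  exists B, (forall k, iset U S (F k) `<=` iset U S B) /\
    ulim U (density R B) <= r + d.
Proof.
move=> d0 Fr.
pose P k n (B : {set S n}) := (\bigcup_(j < k) F j n \subset B)%SET /\
  #|B|%:R / #|S n|%:R <= r + d.
have [j k n B jk [sB Br]|k|B BP] := iset_saturation (P := P).
- split=> //; apply: fintype.subset_trans sB; apply/finset.bigcupsP => i _.
  exact: (finset.bigcup_sup (widen_ord jk i)).
- have := near_density_lt (le_lt_trans (Fr k) (ltr_pwDr d0 (lexx r))).
  apply: filterS => n /ltW Fn; exists (\bigcup_(j < k) F j n)%SET.
  by split=> //; exact: fintype.subxx.
- exists B; split=> [k q|].
    apply: filterS2 (BP k.+1) => n [/fintype.subsetP sB _] Fq; apply: sB.
    by apply/finset.bigcupP; exists ord_max.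
  by apply: ulim_density_le; apply: filterS (BP 0%N) => n [].
Qed.

(** Inner regularity. A countable internal cover of the complement, within [d / 2] of the infimum,
    is swallowed by one internal set at a further cost of [d / 2]; [B] is the complement of that
    set. *)
Lemma internal_inner (Q : set (loeb_space U S)) (d : R) :
  measurable Q -> 0 < d ->
  exists B, iset U S B `<=` Q /\
    (loeb_measure R U S Q <= (ulim U (density R B) + d)%:E)%E.
Proof.
move=> mQ d0; pose mu := @loeb_measure R U UU S.
have mC : measurable (~` Q) by exact: measurableC.
have fC : mu (~` Q) \is a fin_num by exact: fin_num_measure.
have d20 : 0 < d / 2 by rewrite divr_gt0.
have [_ [F [mF QF] <-] Fr] := lb_ereal_inf_adherent d20 fC.
have /choice[f fF] k : exists A, iset U S A = F k.
  by have [A _ AF] := mF k; exists A.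
pose r := fine (mu (~` Q)) + d / 2.
have [k|B [FB Br]] := @internal_cover f r (d / 2) d20.
  apply: le_trans (ulim_density_bigcup_le _ _) _.
  rewrite -lee_fin -sumEFin EFinD fineK//; apply: le_trans (ltW Fr).
  apply: le_trans (nneseries_lim_ge k _); last by move=> *; exact: measure_ge0.
  by rewrite big_mkord; apply: lee_sum => j _; rewrite -fF -icontentE.
exists (fun n => ~: B n)%SET; rewrite -isetC; split.
  rewrite -[Q]setCK; apply: subsetC => q /QF[k _]; rewrite -fF; exact: FB.
have QE : mu Q = (1 - mu (~` Q))%E.
  by rewrite -[in LHS](setCK Q) [LHS](probability_setC mu mC).
rewrite ulim_densityC -/mu QE -(fineK fC) -EFinB lee_fin; move: Br; rewrite /r; lra.
Qed.

End ultraproduct.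

(** * Decency in a finite graph, by counting *)

Section finite_decent.
Context (R : realType) (H : bigraph).

Definition nbr (b : vY H) : {set vX H} := [set a | (a, b) \in edges H]%SET.

(** The exceptional vertices of [decent], with the common denominator [|X|] cleared. *)
Definition mixed (c : R) (A : {set vX H}) : {set vY H} :=
  [set b | (c * #|A|%:R < #|A :&: nbr b|%:R) &&
           (c * #|A|%:R < #|A :\: nbr b|%:R)]%SET.

Definition fdecent (c : R) (A : {set vX H}) : bool :=
  #|mixed c A|%:R <= c * #|vY H|%:R.

Lemma fdecent_le (c d : R) A : c <= d -> fdecent c A -> fdecent d A.
Proof.
move=> cd cA; apply: le_trans (ler_wpM2r _ cd) => //.
apply: le_trans cA; rewrite ler_nat; apply: subset_leq_card.
apply/fintype.subsetP => b; rewrite !inE => /andP[b1 b2].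
have cdA : c * #|A|%:R <= d * #|A|%:R by apply: ler_wpM2r.
by rewrite (le_lt_trans cdA b1) (le_lt_trans cdA b2).
Qed.

Lemma fdecent0 (c : R) : 0 <= c -> fdecent c finset.set0.
Proof.
move=> c0; rewrite /fdecent [mixed _ _](_ : _ = finset.set0) ?cards0 ?mulr_ge0//.
by apply/setP => b; rewrite !inE finset.set0I cards0 mulr0 ltxx.
Qed.

Lemma uniform_measureE (T : finType) (A : {set T}) :
  uniform_measure R [set` A] = (#|A|%:R / #|T|%:R)%:E.
Proof.
rewrite /uniform_measure (eq_card (B := A))// => x.
by rewrite !inE; apply/asboolP/idP.
Qed.

Lemma decentE (c : R) (A : {set vX H}) :
  decent (@uniform_measure R (vX H)) (@uniform_measure R (vY H))
    c [set` edges H] [set` A] <-> fdecent c A.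
Proof.
have X0 : 0 < #|vX H|%:R :> R by rewrite ltr0n neFin_gt0.
have Y0 : 0 < #|vY H|%:R :> R by rewrite ltr0n neFin_gt0.
rewrite /decent /fdecent [X in uniform_measure _ X](_ : _ = [set` mixed c A]).
  by rewrite uniform_measureE lee_fin ler_pdivrMr.
apply/seteqP; split=> b /=; rewrite !inE.
all: have -> : [set` A] `&` fiber [set` edges H] b = [set` (A :&: nbr b)%SET]
  by apply/seteqP; split=> a /=; rewrite !inE; [case=> -> -> | case/andP].
all: have -> : [set` A] `\` fiber [set` edges H] b = [set` (A :\: nbr b)%SET]
  by apply/seteqP; split=> a /=; rewrite !inE; [case=> -> /negP ->|
    case/andP => /negP].
all: rewrite !uniform_measureE -!EFinM !lte_fin !mulrA !ltr_pM2r ?invr_gt0//.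
  by case=> -> ->.
by case/andP.
Qed.

End finite_decent.

(** * Perfection of internal sets against decency in the factors *)

Section ultraproduct_of_graphs.
Context (R : realType) (U : set_system nat) {UU : UltraFilter U}
  (G : nat -> bigraph).
Local Notation X := (fun n => vX (G n)).
Local Notation Y := (fun n => vY (G n)).
Local Notation mu := (@loeb_measure R U UU X).
Local Notation nu := (@loeb_measure R U UU Y).

Lemma fiber_iset (q : uprod U Y) :
  fiber (uedges U G) q = iset U X (fun n => nbr (repr q n)).
Proof.
by apply/seteqP; split=> p; apply: filterS => n /=; rewrite inE.
Qed.

(** Special to eps = 0: the threshold is then 0 for every set, so a vertex that splits [P] also
    splits [Q]. For eps > 0 the threshold shrinks with the set. *)
Lemma perfect_sub (P Q : set (loeb_space U X)) :
  P `<=` Q -> perfect mu nu (uedges U G) Q -> perfect mu nu (uedges U G) P.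
Proof.
move=> PQ; apply: le_trans; apply: loeb_measure_mono => q /=.
rewrite !mul0e => -[q1 q2]; split.
  by apply: lt_le_trans q1 _; apply: loeb_measure_mono; exact: setSI.
by apply: lt_le_trans q2 _; apply: loeb_measure_mono; exact: setSD.
Qed.

Lemma perfect_null (Q : set (loeb_space U X)) :
  mu Q = 0%E -> perfect mu nu (uedges U G) Q.
Proof.
move=> Q0; rewrite /perfect /decent [X in nu X](_ : _ = set0) ?loeb_measure0//.
apply/seteqP; split=> // q /= [] /lt_le_trans/(_ (loeb_measure_mono (@subIsetl _ _ _))).
by rewrite Q0 mule0 ltxx.
Qed.

(** Otherwise the sets [mixed c (A n)] have density at least [c] for almost every [n], so they form
    an internal set of measure at least [c]. All its points split [A] into two parts of positive
    measure, against perfection. *)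
Lemma near_fdecent (A : forall n, {set X n}) (c : R) : 0 < c ->
  0 < ulim U (density R A) -> perfect mu nu (uedges U G) (iset U X A) ->
  \forall n \near U, fdecent c (A n).
Proof.
move=> c0 A0 Ap; apply: contrapT => /near_contra nd.
have : c <= ulim U (density R (fun n => mixed c (A n))).
  apply: ulim_density_ge; apply: filterS nd => n /negP; rewrite -ltNge => /ltW.
  by rewrite /density ler_pdivlMr// ltr0n neFin_gt0.
suff : ulim U (density R (fun n => mixed c (A n))) <= 0 by lra.
rewrite -lee_fin -loeb_measure_iset; apply: le_trans Ap; apply: loeb_measure_mono.
move=> q /= qm; rewrite mul0e fiber_iset isetI setDE isetC isetI.
(* Halving the limit density of [A] leaves room for a strict lower bound on the density of almost
   every [A n]. *)
have cA0 : 0 < c * ulim U (density R A) / 2 by rewrite divr_gt0// mulr_gt0.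
have gt0 (B : forall n, {set X n}) :
    (\forall n \near U, c * #|A n|%:R < #|B n|%:R) -> (0 < mu (iset U X B))%E.
  move=> AB; rewrite loeb_measure_iset lte_fin; apply: lt_le_trans cA0 _.
  apply: ulim_density_ge.
  have A2 : ulim U (density R A) / 2 < ulim U (density R A) by lra.
  apply: filterS2 AB (near_density_gt A2) => n AB An.
  apply/ltW; apply: (@lt_trans _ _ (c * density R A n)).
    by rewrite -mulrA ltr_pM2l.
  by rewrite /density mulrA ltr_pM2r// invr_gt0 ltr0n neFin_gt0.
split; apply: gt0; apply: filterS qm => n; rewrite inE => /andP[//].
by rewrite finset.setDE.
Qed.

(** The vertices splitting [A] form the union of the sets [D k], whose thresholds are absolute, not
    relative to [mu A]. For every [m >= k], [D k] lies in the internal set of [1/(m+1)]-mixed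
    vertices, of measure at most [1/(m+1)]; so [D k] is null. *)
Lemma fdecent_perfect (A : forall n, {set X n}) :
  (forall k, \forall n \near U, fdecent (k.+1%:R^-1 : R) (A n)) ->
  perfect mu nu (uedges U G) (iset U X A).
Proof.
move=> dA.
pose D k : set (loeb_space U Y) := [set q |
  (k.+1%:R^-1%:E < mu (iset U X A `&` fiber (uedges U G) q))%E /\
  (k.+1%:R^-1%:E < mu (iset U X A `\` fiber (uedges U G) q))%E].
have D0 k : nu (D k) = 0%E.
  apply/eqP; rewrite eq_le measure_ge0 andbT; apply/lee_addgt0Pr => e e0.
  rewrite add0e.
  have [m [km me]] : exists m, (k <= m)%N /\ m.+1%:R^-1 <= e.
    have [N _ eN] := near_infty_natSinv_lt (PosNum e0).
    by exists (maxn k N); rewrite leq_maxl; split=> //; apply/ltW/eN/leq_maxr.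
  apply: (@le_trans _ _ (nu (iset U Y (fun n => mixed (m.+1%:R^-1 : R) (A n))))).
    apply: loeb_measure_mono => q; rewrite /D /=.
    rewrite fiber_iset isetI setDE isetC isetI !loeb_measure_iset !lte_fin.
    move=> [/near_density_gt q1 /near_density_gt q2].
    apply: filterS2 q1 q2 => n q1 q2; rewrite inE finset.setDE.
    have X0 : 0 < #|X n|%:R :> R by rewrite ltr0n neFin_gt0.
    (* From an absolute threshold to a relative one, by [|A n| <= |X n|]. *)
    have le_km (x : nat) : k.+1%:R^-1 < x%:R / #|X n|%:R :> R ->
        m.+1%:R^-1 * #|A n|%:R < x%:R :> R.
      rewrite ltr_pdivlMr//; apply: le_lt_trans; apply: ler_pM => //.
        by rewrite lef_pV2 ?posrE ?ltr0n// ler_nat.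
      by rewrite ler_nat max_card.
    by rewrite !le_km.
  rewrite loeb_measure_iset lee_fin; apply: le_trans me.
  apply: ulim_density_le; apply: filterS (dA m) => n.
  by rewrite /density ler_pdivrMr// ltr0n neFin_gt0.
apply: (@le_trans _ _ (nu (\bigcup_k D k))); last first.
  by rewrite loeb_measure_bigcup0.
apply: loeb_measure_mono => q /=; rewrite mul0e fiber_iset isetI setDE isetC isetI.
rewrite !loeb_measure_iset !lte_fin => -[q1 q2].
have [N1 _ /(_ N1 (leqnn _)) N1q] := near_infty_natSinv_lt (PosNum q1).
have [N2 _ /(_ N2 (leqnn _)) N2q] := near_infty_natSinv_lt (PosNum q2).
exists (maxn N1 N2) => //; rewrite /D /= fiber_iset isetI setDE isetC isetI.
rewrite !loeb_measure_iset !lte_fin; split.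
  apply: le_lt_trans N1q; rewrite lef_pV2 ?posrE ?ltr0n// ler_nat ltnS.
  exact: leq_maxl.
apply: le_lt_trans N2q; rewrite lef_pV2 ?posrE ?ltr0n// ler_nat ltnS.
exact: leq_maxr.
Qed.

End ultraproduct_of_graphs.

(** * From perfect partitions to decent ones *)

Definition perfectly_partitioned (R : realType) (U : set_system nat)
    {UU : UltraFilter U} (G : nat -> bigraph) : Prop :=
  exists A : nat -> set (loeb_space U (fun n => vX (G n))),
    [/\ forall k, <<s internal U (fun n => vX (G n)) >> (A k),
        trivIset setT A,
        \bigcup_k A k = setT
      & forall k, perfect (loeb_measure R U (fun n => vX (G n)))
                          (loeb_measure R U (fun n => vY (G n)))
                          (uedges U G) (A k)].

Definition decently_partitioned (R : realType) (H : bigraph) (eps : R)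
    (f : nat -> R) (N' : nat) : Prop :=
  exists A : nat -> {set vX H},
    [/\ (forall s t, (s < N')%N -> (t < N')%N -> s <> t ->
          (A s :&: A t)%SET = finset.set0),
        (\bigcup_(t < N') A t)%SET = finset.setT,
        #|A 0%N|%:R <= eps * #|vX H|%:R
      & forall t, (1 <= t < N')%N -> fdecent (f N') (A t)].

Section perfect_to_decent.
Context (R : realType) (U : set_system nat) {UU : UltraFilter U}
  (G : nat -> bigraph).
Local Notation X := (fun n => vX (G n)).
Local Notation Y := (fun n => vY (G n)).
Local Notation mu := (@loeb_measure R U UU X).
Local Notation nu := (@loeb_measure R U UU Y).

Lemma near_decent_inner (Q : set (loeb_space U X)) (c d : R) :
  measurable Q -> perfect mu nu (uedges U G) Q -> 0 < c -> 0 < d ->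
  exists B : forall n, {set X n},
    [/\ iset U X B `<=` Q, (mu Q <= (ulim U (density R B) + d)%:E)%E
      & \forall n \near U, fdecent c (B n)].
Proof.
move=> mQ pQ c0 d0; have [B [BQ QB]] := internal_inner mQ d0.
have [B0|B0] := ltP 0 (ulim U (density R B)).
  by exists B; split=> //; apply: near_fdecent => //; exact: perfect_sub pQ.
(* When [B] has limit density 0, [near_fdecent] does not apply; the empty set is decent and
   approximates [Q] as well. *)
exists (fun=> finset.set0); split.
- by rewrite iset0.
- apply: le_trans QB _; rewrite lee_fin ulim_density0; lra.
- by apply: filterE => n; apply: fdecent0; exact: ltW.
Qed.

(** The order of choices matters: [K] comes from [eps] and the perfect sets alone, so the precision
    [f K.+1] is fixed before the internal approximations are chosen. *)
Lemma near_decently_partitioned (eps : R) (f : nat -> R) :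
  0 < eps -> (forall n, 0 < f n) -> @perfectly_partitioned R U UU G ->
  exists K, \forall n \near U, decently_partitioned (G n) eps f K.+1.
Proof.
move=> eps0 f0 [Q [mQ tQ QT pQ]].
have fQ k : mu (Q k) \is a fin_num by apply: fin_num_measure; exact: mQ.
have [K KQ] : exists K, 1 - eps / 2 < \sum_(k < K) fine (mu (Q k)).
  apply: contrapT => /forallNP nK.
  have := @measure_sigma_additive _ _ _ mu Q mQ tQ.
  have muT : mu setT = 1%E by exact: probability_setT.
  rewrite QT /= muT => cQ.
  suff : (1 <= (1 - eps / 2)%:E :> \bar R)%E by rewrite lee_fin; lra.
  rewrite -(cvg_lim _ cQ)//; apply: lime_le; first exact: cvgP cQ.
  apply: filterE => n; have /negP := nK n; rewrite -leNgt -lee_fin.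
  rewrite -sumEFin big_mkord; apply: le_trans.
  by apply: lee_sum => k _; rewrite fineK.
(* The total loss [K * d] is at most [eps / 2]; dividing by [K.+1] also covers [K = 0]. *)
pose d := eps / 2 / K.+1%:R.
have d0 : 0 < d by rewrite !divr_gt0.
have /choice[B BP] k := near_decent_inner (mQ k) (pQ k) (f0 K.+1) d0.
exists K.
have Bdisj i j : i <> j -> (\forall n \near U, B i n :&: B j n = finset.set0)%SET.
  move=> ij; apply: iset_eq; rewrite iset0 -isetI; apply/seteqP; split=> // q.
  have [/(_ q) Bi _ _] := BP i; have [/(_ q) Bj _ _] := BP j.
  by move=> [/Bi qi /Bj qj]; apply: ij; apply: tQ => //; exists q.
have sB : 1 - eps < \sum_(k < K) ulim U (density R (B k)).
  have : \sum_(k < K) fine (mu (Q k)) <=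
         \sum_(k < K) (ulim U (density R (B k)) + d).
    by apply: ler_sum => k _; have [_ + _] := BP k; rewrite -lee_fin fineK.
  rewrite big_split/= sumr_const card_ord -mulr_natl => QB.
  have : K%:R * d <= eps / 2.
    rewrite /d mulrCA ler_piMr//; first by apply: divr_ge0; exact: ltW.
    by rewrite ler_pdivrMr// mul1r ler_nat.
  move: KQ QB; lra.
have cB : ulim U (density R (fun n => ~: \bigcup_(k < K) B k n)%SET) < eps.
  rewrite ulim_densityC ulim_density_bigcup; first by move: sB; lra.
  by move=> i j ij; apply: Bdisj => ijE; rewrite ijE ltnn in ij.
have nB : \forall n \near U, forall k : 'I_K, fdecent (f K.+1) (B k n).
  by apply: filter_forall => k; have [] := BP k.
(* Each pair is disjoint only for almost every [n]; there being finitely many pairs, one large set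
   of indices serves them all. *)
have dB : \forall n \near U, forall p : 'I_K * 'I_K, p.1 <> p.2 ->
    (B p.1 n :&: B p.2 n)%SET = finset.set0.
  apply: filter_forall => -[i j] /=.
  have [->|ij] := eqVneq i j; first exact: filterE.
  have ijv : (i : nat) <> j by move=> /val_inj ijE; rewrite ijE eqxx in ij.
  by move: (Bdisj i j ijv); apply: filterS.
move: nB dB (@near_density_lt _ _ UU _ _ _ cB); apply: filterS3 => n nB dB An.
(* Part 0 is what the approximations leave uncovered, hence the shift of indices. *)
pose A t := if t is k.+1 then B k n else (~: \bigcup_(k < K) B k n)%SET.
have A0B k : (k < K)%N -> (A 0%N :&: B k n)%SET = finset.set0.
  move=> kK; apply/setP => x; rewrite !inE; apply/negP => /andP[/negP + xB].
  by apply; apply/finset.bigcupP; exists (Ordinal kK).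
exists A; split.
- move=> [|i] [|j]//; rewrite !ltnS => iK jK ij; first exact: A0B.
    by rewrite finset.setIC; exact: A0B.
  by apply: (dB (Ordinal iK, Ordinal jK)) => -[/= ijE]; apply: ij; rewrite ijE.
- by rewrite big_ord_recl/= finset.setUC finset.setUCr.
- move: An; rewrite /density ltr_pdivrMr ?ltr0n ?neFin_gt0//; exact: ltW.
- move=> [|k]// /andP[_]; rewrite ltnS => kK; exact: (nB (Ordinal kK)).
Qed.

End perfect_to_decent.

Lemma perfect_imp_decent (R : realType) (F : bigraph -> Prop) :
  (forall (U : set_system nat) (UU : UltraFilter U) (G : nat -> bigraph),
    (forall n, F (G n)) -> @perfectly_partitioned R U UU G) ->
  forall (eps : R) (f : nat -> R), 0 < eps -> (forall n, 0 < f n) ->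
  exists N, forall H, F H ->
    exists N', (N' <= N)%N /\ decently_partitioned H eps f N'.
Proof.
move=> pF eps f eps0 f0; apply: contrapT => /forallNP nN.
have /choice[G GP] N : exists H, F H /\
    forall N', (N' <= N)%N -> ~ decently_partitioned H eps f N'.
  have /existsNP[H /not_implyP[FH /forallNP nH]] := nN N.
  by exists H; split=> // N' N'N dH; apply: (nH N').
(* [U] extends the cofinite filter, so almost every [n] exceeds [K] and [K.+1] is among the sizes
   that [G n] refutes. *)
have [U [UU leU]] := ultraFilterLemma eventually_filter.
have [K GK] := near_decently_partitioned eps0 f0 (pF U UU G (fun n => (GP n).1)).
have [n [Kn /((GP n).2 K.+1)]] := filter_ex (filterI (leU _ (nbhs_infty_gt K)) GK).
exact.
Qed.

(** * From decent partitions to perfect ones *)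

Lemma card_bigcup_le (T : finType) (A : nat -> {set T}) k :
  (#|\bigcup_(j < k) A j|%SET <= \sum_(j < k) #|A j|)%N.
Proof.
elim: k => [|k IH]; first by rewrite big_ord0 cards0.
rewrite !big_ord_recr/= cardsU; apply: leq_trans (leq_subr _ _) _.
by rewrite leq_add2r.
Qed.

(** Pigeonhole: part 0 covers at most half of the vertices, and the other [N' - 1] parts cannot
    cover the rest if each has at most [|X| / (2 N')] of them. *)
Lemma large_decent_part (R : realType) (H : bigraph) (f : nat -> R) N' :
  decently_partitioned H (1 / 2) f N' ->
  exists A : {set vX H}, #|vX H|%:R <= 2 * N'%:R * #|A|%:R :> R /\
    fdecent (f N') A.
Proof.
move=> [A [_ AT A0 dA]]; apply: contrapT => nA.
have X0 : 0 < #|vX H|%:R :> R by rewrite ltr0n neFin_gt0.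
have small t : (1 <= t < N')%N -> 2 * N'%:R * #|A t|%:R <= #|vX H|%:R :> R.
  move=> tN; rewrite leNgt; apply/negP => /ltW tX; apply: nA.
  by exists (A t); split=> //; exact: dA.
have := card_bigcup_le A N'; rewrite AT cardsT -(ler_nat R).
case: N' {AT nA dA} small => [|M] small.
  (* Zero parts cannot cover the nonempty [vX H]. *)
  by rewrite big_ord0 leNgt X0.
rewrite big_ord_recl natrD natr_sum => XA.
have : \sum_(i < M) #|A (lift ord0 i)|%:R <=
       \sum_(i < M) (#|vX H|%:R / (2 * M.+1%:R)) :> R.
  apply: ler_sum => i _; rewrite ler_pdivlMr ?mulr_gt0// mulrC.
  by apply: small; rewrite lift0 [(_ < M.+1)%N]ltnS ltn_ord.
rewrite sumr_const card_ord -[leRHS]mulr_natl => SA.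
have y0 : 0 < #|vX H|%:R / (2 * M.+1%:R) :> R by rewrite divr_gt0// mulr_gt0.
(* Half of [|X|] is [M.+1] equal shares, of which the [M] parts use at most [M]; the spare positive
   share gives the contradiction. *)
have xE : #|vX H|%:R / 2 =
    M%:R * (#|vX H|%:R / (2 * M.+1%:R)) + #|vX H|%:R / (2 * M.+1%:R) :> R.
  have : M.+1%:R != 0 :> R by rewrite pnatr_eq0.
  by rewrite -natr1 => ?; field.
move: y0 xE XA SA A0; rewrite /=.
set y := #|vX H|%:R / (2 * _); set z := M%:R * y; lra.
Qed.

(* [Defs.induced]: the name is shadowed by lebesgue_integral's [induced]. *)
Lemma fdecent_induced (R : realType) (H : bigraph) (X' : {set vX H})
    (X'0 : (0 < #|X'|)%N) (YT0 : (0 < #|[set: vY H]%SET|)%N) (c : R)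
    (A : {set vX (Defs.induced X'0 YT0)}) :
  fdecent c A -> fdecent c (val @: A)%SET.
Proof.
have card_val (B : {set vX (Defs.induced X'0 YT0)}) : #|(val @: B)%SET| = #|B|.
  exact/card_imset/val_inj.
have nbrE (b : vY (Defs.induced X'0 YT0)) :
    nbr b = [set a | val a \in nbr (val b)]%SET.
  by apply/setP => a; rewrite !inE.
have valI (b : vY (Defs.induced X'0 YT0)) :
    #|(val @: A :&: nbr (val b))%SET| = #|(A :&: nbr b)%SET|.
  rewrite -card_val; congr (#|pred_of_set _|); apply/setP => x; apply/idP/idP.
    rewrite inE => /andP[/imsetP[a aA ->] ab].
    by apply/imsetP; exists a => //; rewrite inE aA nbrE inE.
  by move=> /imsetP[a + ->]; rewrite nbrE !inE => /andP[aA ->]; rewrite imset_f.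
have valD (b : vY (Defs.induced X'0 YT0)) :
    #|(val @: A :\: nbr (val b))%SET| = #|(A :\: nbr b)%SET|.
  apply/eqP; rewrite -(eqn_add2l #|(A :&: nbr b)%SET|) cardsID -valI cardsID.
  by rewrite card_val.
(* Decency refers to [|A|] and [|Y|] but not to [|X|]; as all of [Y] is kept, comparing the sets of
   mixed vertices suffices. *)
rewrite /fdecent card_sig/= cardsT; apply: le_trans; rewrite ler_nat.
rewrite -[leqRHS](card_imset _ val_inj); apply: subset_leq_card.
apply/fintype.subsetP => b bm.
have bT : b \in [set: vY H]%SET by rewrite inE.
apply/imsetP; exists (exist _ b bT) => //.
by move: bm; rewrite !inE card_val -valI -valD.
Qed.

Section decent_to_perfect.
Context (R : realType) (F : bigraph -> Prop).
Hypothesis hF : hereditarily_closed F.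
Hypothesis dF : forall (eps : R) (f : nat -> R),
  0 < eps -> (forall n, 0 < f n <= 1) ->
  exists N, forall H, F H ->
    exists N', (N' <= N)%N /\ decently_partitioned H eps f N'.

Context (U : set_system nat) {UU : UltraFilter U}
  (G : nat -> bigraph) (GF : forall n, F (G n)).
Local Notation X := (fun n => vX (G n)).
Local Notation Y := (fun n => vY (G n)).
Local Notation mu := (@loeb_measure R U UU X).
Local Notation nu := (@loeb_measure R U UU Y).
Local Notation iperfect A := (perfect mu nu (uedges U G) (iset U X A)).

Lemma internal_perfect_subset (Z : forall n, {set X n}) :
  0 < ulim U (density R Z) ->
  exists A, [/\ iset U X A `<=` iset U X Z, 0 < ulim U (density R A)
              & iperfect A].
Proof.
move=> Z0.
pose P (a : R) k n (A : {set X n}) := [/\ (A \subset Z n)%SET,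
  a * #|X n|%:R <= #|A|%:R & fdecent (k.+1%:R^-1 : R) A].
have [[a a0 aP]|nP] := pselect (exists2 a, 0 < a &
    forall k, \forall n \near U, exists A, P a k n A).
  have [j k n A jk [AZ Aa Ad]|A AP] := iset_saturation _ aP.
    split=> //; apply: fdecent_le Ad.
    by rewrite lef_pV2 ?posrE ?ltr0n// ler_nat.
  exists A; split.
  - by move=> q; apply: filterS2 (AP 0%N) => n [/fintype.subsetP AZ _ _] /AZ.
  - apply: lt_le_trans a0 _; apply: ulim_density_ge; apply: filterS (AP 0%N).
    by move=> n [_ + _]; rewrite /density ler_pdivlMr// ltr0n neFin_gt0.
  - by apply: fdecent_perfect => k; apply: filterS (AP k) => n [].
(* For almost every [n], no subset of [Z n] of density at least [a] in [X n] reaches precision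
   [K a]; the value 0 for [a <= 0] is a dummy. *)
have /choice[K KP] (a : R) : exists k, 0 < a ->
    \forall n \near U, forall A, ~ P a k n A.
  have [a0|] := ltP 0 a; last by exists 0%N.
  have /existsNP[k /near_contra nPk] : ~ forall k,
      \forall n \near U, exists A, P a k n A.
    by move=> aP; apply: nP; exists a.
  by exists k => _; apply: filterS nPk => n /forallNP.
(* With eps = 1/2, some part among the N' has density at least
   (1/2) / N' in Z_n, hence at least (mu Z / 4) / N' in the n-th graph. *)
pose a m := ulim U (density R Z) / 4 / m.+1%:R.
have a0 m : 0 < a m by rewrite !divr_gt0.
(* The density of the large part is only known once the number [m] of parts is; so the precision to
   be contradicted must depend on [m], as (2) allows. *)
pose f m : R := (K (a m)).+1%:R^-1.
have f01 m : 0 < f m <= 1.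
  by rewrite invr_gt0 ltr0n/= invf_le1 ?ltr0n// ler1n.
have [N NP] := dF (divr_gt0 ltr01 (ltr0Sn R 1)) f01.
(* The uniform bound [N] leaves finitely many values of [N'], so a single [n] can exclude them
   all. *)
have nA : \forall n \near U, forall m : 'I_N.+1, forall A, ~ P (a m) (K (a m)) n A.
  by apply: filter_forall => m; exact: KP.
have Z2 : ulim U (density R Z) / 2 < ulim U (density R Z) by lra.
have [n [/= {}nA Zn]] := filter_ex (filterI nA (near_density_gt Z2)).
have X0 : 0 < #|X n|%:R :> R by rewrite ltr0n neFin_gt0.
have Zn0 : (0 < #|Z n|)%N.
  rewrite -(ltr0n R); move: Zn; rewrite /density ltr_pdivlMr//.
  by apply: lt_trans; rewrite mulr_gt0// divr_gt0.
have YT0 : (0 < #|[set: Y n]%SET|)%N by rewrite cardsT neFin_gt0.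
have [N' [N'N /large_decent_part[A [ZA dA]]]] := NP _ (hF (GF n) Zn0 YT0).
have [B [BZ ZB dB]] : exists B : {set X n}, [/\ (B \subset Z n)%SET,
    #|Z n|%:R <= 2 * N'%:R * #|B|%:R :> R & fdecent (f N') B].
  exists (val @: A)%SET; split; last exact: fdecent_induced.
    by apply/fintype.subsetP => _ /imsetP[x _ ->]; exact: valP.
  rewrite (card_imset _ val_inj); apply: le_trans ZA.
  by rewrite [X in _ <= X%:R]card_sig.
have NN : (N' < N.+1)%N by [].
exfalso; apply: (nA (Ordinal NN) B); split=> //.
have ZX : ulim U (density R Z) / 2 * #|X n|%:R < #|Z n|%:R.
  by rewrite -ltr_pdivlMr.
have B0 : 0 <= #|B|%:R :> R by [].
rewrite /a/= mulrAC ler_pdivrMr// -[N'.+1%:R]natr1.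
by move: ZX ZB B0; lra.
Qed.

(** Inclusion in a union that may overlap makes the notion stable under subsets and countable
    unions; disjointness is restored at the end. *)
Definition perfectly_covered (Q : set (loeb_space U X)) : Prop :=
  exists P : nat -> forall n, {set X n},
    (forall k, iperfect (P k)) /\ Q `<=` \bigcup_k iset U X (P k).

Lemma perfectly_coveredS Q Q' : Q `<=` Q' ->
  perfectly_covered Q' -> perfectly_covered Q.
Proof.
by move=> QQ' [P [pP Q'P]]; exists P; split=> //; exact: subset_trans Q'P.
Qed.

Lemma perfectly_covered_bigcup (Q : nat -> set (loeb_space U X)) :
  (forall k, perfectly_covered (Q k)) -> perfectly_covered (\bigcup_k Q k).
Proof.
move=> /choice[P PP].
(* Codes of no pair default to [(0, 0)], which merely repeats a set. *)
pose ij k := odflt (0, 0)%N (unpickle k).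
exists (fun k => P (ij k).1 (ij k).2); split=> [k|q [i _ /(PP i).2[j _ qP]]].
  exact: (PP _).1.
by exists (pickle (i, j)) => //; rewrite /ij pickleK.
Qed.

Lemma iset_perfectly_covered A : iperfect A -> perfectly_covered (iset U X A).
Proof. by move=> pA; exists (fun=> A); split=> // q qA; exists 0%N. Qed.

Lemma perfectly_coveredU Q Q' : perfectly_covered Q -> perfectly_covered Q' ->
  perfectly_covered (Q `|` Q').
Proof.
move=> cQ cQ'; pose W k := if k is 0%N then Q else Q'.
apply: (@perfectly_coveredS _ (\bigcup_k W k)).
  by move=> q [Qq|Qq]; [exists 0%N|exists 1%N].
by apply: perfectly_covered_bigcup => -[|k].
Qed.

(** Exhaustion: let the densities of the covered sets [A k] approach [sup E]. If [sup E < 1], some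
    internal [B] of measure below 1 contains all the [A k]; a perfect [D] of positive measure
    outside [B], joined to [A k] for large [k], then exceeds [sup E]. *)
Lemma perfectly_covered_conull : exists A : nat -> forall n, {set X n},
  (forall k, iperfect (A k)) /\ mu (~` \bigcup_k iset U X (A k)) = 0%E.
Proof.
pose E := [set ulim U (density R A) | A in
  [set A | perfectly_covered (iset U X A)]].
have E1 : ubound E 1 by move=> _ [A _ <-]; have /andP[] := @ulim_density01 R U UU _ A.
have c0 : perfectly_covered (iset U X (fun=> finset.set0)).
  by apply: iset_perfectly_covered; apply: perfect_null; rewrite iset0 loeb_measure0.
have hE : has_sup E.
  by split; [eexists; exists (fun=> finset.set0)|exists 1].
have /choice[A AP] k : exists A, perfectly_covered (iset U X A) /\
    sup E - k.+1%:R^-1 < ulim U (density R A).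
  have [|_ [A cA <-] EA] := @sup_adherent R E k.+1%:R^-1 _ hE.
    by rewrite invr_gt0.
  by exists A.
have supE B : perfectly_covered (iset U X B) -> ulim U (density R B) <= sup E.
  by move=> cB; apply: sup_upper_bound => //; exists B.
have s1 : 1 <= sup E.
  rewrite leNgt; apply/negP => s1.
  pose d := (1 - sup E) / 2; have d0 : 0 < d by rewrite divr_gt0// subr_gt0.
  have [k|B [AB Bs]] := internal_cover (F := A) (r := sup E) d0.
    apply: supE.
    apply: (@perfectly_coveredS _ (\bigcup_j iset U X (A j))).
      by rewrite iset_bigcup => q [j _ Aq]; exists j.
    by apply: perfectly_covered_bigcup => j; exact: (AP j).1.
  have [|D [DB D0 pD]] := @internal_perfect_subset (fun n => ~: B n)%SET.
    by rewrite ulim_densityC; move: Bs d0; rewrite /d; lra.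
  have [k kD] : exists k, k.+1%:R^-1 < ulim U (density R D).
    by have [k _ /(_ k (leqnn _))] := near_infty_natSinv_lt (PosNum D0); exists k.
  have := supE (fun n => D n :|: A k n)%SET; rewrite -isetU ulim_densityD.
    have [cA sA] := AP k.
    have cD := iset_perfectly_covered pD.
    move=> /(_ (perfectly_coveredU cD cA)).
    apply/negP; rewrite -ltNge addrC -ltrBlDr (lt_trans _ sA)//.
    by rewrite ltrD2l ltrN2.
  apply: iset_eq; rewrite iset0 -isetI; apply/seteqP; split=> // q.
  by move=> [/DB + /AB]; rewrite -isetC.
have [P [pP AP']] : perfectly_covered (\bigcup_k iset U X (A k)).
  by apply: perfectly_covered_bigcup => k; exact: (AP k).1.
exists P; split=> //.
apply/eqP; rewrite eq_le measure_ge0 andbT; apply/lee_addgt0Pr => e e0.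
rewrite add0e.
have [k ke] : exists k, k.+1%:R^-1 < e.
  by have [k _ /(_ k (leqnn _))] := near_infty_natSinv_lt (PosNum e0); exists k.
apply: (@le_trans _ _ (mu (iset U X (fun n => ~: A k n)%SET))).
  apply: loeb_measure_mono; rewrite -isetC; apply: subsetC.
  by apply: subset_trans AP' => q; exists k.
rewrite loeb_measure_iset lee_fin ulim_densityC.
have [_ sA] := AP k; rewrite lerBlDr (le_trans s1)// addrC -lerBlDr ltW//.
by apply: lt_trans sA; rewrite ltrD2l ltrN2.
Qed.

Lemma decent_imp_perfect : @perfectly_partitioned R U UU G.
Proof.
have [A [pA A0]] := perfectly_covered_conull.
(* The null remainder is perfect, so it can serve as a part; [perfect_sub] keeps the parts perfect
   when [seqDU] makes them disjoint. *)
pose T k : set (@loeb_space U UU X) :=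
  if k is k.+1 then @iset U UU X (A k) else ~` \bigcup_k @iset U UU X (A k).
have mT k : measurable (T k).
  case: k => [|k]; last exact: measurable_iset.
  by apply: measurableC; apply: bigcup_measurable => k _; exact: measurable_iset.
exists (seqDU T); split.
- exact: (@seqDU_measurable _ (loeb_space U X) T mT).
- exact: trivIset_seqDU.
- rewrite -seqDU_bigcup_eq; apply/seteqP; split=> // q _.
  have [[k _ qA]|nq] := pselect ((\bigcup_k iset U X (A k)) q).
    by exists k.+1.
  by exists 0%N.
- move=> k; apply: perfect_sub (@subset_seqDU _ T k) _.
  by case: k => [|k]; [exact: perfect_null|exact: pA].
Qed.

End decent_to_perfect.

Theorem proposition4p7 (R : realType) (F : bigraph -> Prop)
    (hF : hereditarily_closed F) :
  (forall (U : set_system nat) (UU : UltraFilter U) (G : nat -> bigraph),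
    (forall n, F (G n)) ->
    exists A : nat -> set (loeb_space U (fun n => vX (G n))),
      [/\ forall k, <<s internal U (fun n => vX (G n)) >> (A k),
          trivIset setT A,
          \bigcup_k A k = setT
        & forall k, perfect (loeb_measure R U (fun n => vX (G n)))
                            (loeb_measure R U (fun n => vY (G n)))
                            (uedges U G) (A k)])
  <->
  (forall (eps : R) (f : nat -> R),
    0 < eps -> (forall n, 0 < f n <= 1) ->
    exists N : nat, forall H : bigraph, F H ->
      exists (N' : nat) (A : nat -> {set vX H}),
        [/\ (N' <= N)%N,
            (forall s t, (s < N')%N -> (t < N')%N -> s <> t ->
              (A s :&: A t)%SET = finset.set0),
            (\bigcup_(t < N') A t)%SET = finset.setT,
            #|A 0%N|%:R <= eps * #|vX H|%:R
          & forall t, (1 <= t < N')%N ->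
              decent (@uniform_measure R (vX H)) (@uniform_measure R (vY H))
                (f N') [set` edges H] [set` A t]]).
Proof.
split=> [pF eps f eps0 f01|dF U UU G GF].
  have f0 n : 0 < f n by have /andP[] := f01 n.
  have [N NP] := perfect_imp_decent pF eps0 f0.
  exists N => H /NP[N' [N'N [A [Adisj AT A0 dA]]]]; exists N', A; split=> // t tN.
  by apply/decentE; exact: dA.
apply: (decent_imp_perfect hF) => // eps f eps0 f01.
have [N NP] := dF eps f eps0 f01.
exists N => H /NP[N' [A [N'N Adisj AT A0 dA]]]; exists N'; split=> //.
by exists A; split=> // t tN; apply/decentE; exact: dA.
Qed.
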